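(* Let $k,m,n$ be positive integers and $\varepsilon=\exp(2\pi\sqrt{-1}/k)$. Let $T,B\in Mat_n(\mathbb{C})$ be matrices such that $$B^k=\mathbf 1,\qquad BT=\varepsilon\,TB .$$ Fix generic numbers $\lambda_1,\dots,\lambda_m,t_1,\dots,t_m\in\mathbb{C}$ such that $T^k-\lambda_\alpha^k\mathbf 1$ is invertible for all $\alpha=1,\dots,m$. Define $R(x)=(R_1(x),\dots,R_m(x))$ on $(Mat_n)^m$ by $$R_\alpha(x)=\sum_{(i,\beta)\ne(0,\alpha)}\frac{t_\beta}{\varepsilon^i\lambda_\beta-\lambda_\alpha}\cdot\frac{T-\lambda_\alpha}{\varepsilon^{-i}T-\lambda_\beta}B^{-i}x_\beta B^i+\Big(\frac{t_\alpha}{T-\lambda_\alpha}-\sum_{(i,\beta)\ne(0,\alpha)}\frac{\varepsilon^i t_\beta}{\varepsilon^i\lambda_\beta-\lambda_\alpha}\Big)x_\alpha .$$ Then the formula $x\circ y=R(x)y+xR(y)-R(xy)$ defines the following associative product on $(Mat_n)^m$, compatible with the standard product in $(Mat_n)^m$: $x\circ y=((x\circ y)_1,\dots,(x\circ y)_m)$, where $$(x\circ y)_\alpha=\sum_{(i,\beta)\ne(0,\alpha)}\frac{t_\beta}{\varepsilon^i\lambda_\beta-\lambda_\alpha}\Big(\frac{T-\lambda_\alpha}{\varepsilon^{-i}T-\lambda_\beta}B^{-i}x_\beta B^i y_\alpha+x_\alpha\frac{T-\lambda_\alpha}{\varepsilon^{-i}T-\lambda_\beta}B^{-i}y_\beta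 B^i-\frac{T-\lambda_\alpha}{\varepsilon^{-i}T-\lambda_\beta}B^{-i}x_\beta y_\beta B^i\Big)$$ $$\qquad+\,t_\alpha x_\alpha\frac{1}{T-\lambda_\alpha}y_\alpha-\sum_{(i,\beta)\ne(0,\alpha)}\frac{\varepsilon^i t_\beta}{\varepsilon^i\lambda_\beta-\lambda_\alpha}x_\alpha y_\alpha .$$
   Context: $Mat_n=Mat_n(\mathbb{C})$ is the algebra of complex $n\times n$ matrices and $\mathbf 1$ is the identity matrix. Elements of $(Mat_n)^m$, the direct sum of $m$ copies of $Mat_n$, are written $x=(x_1,\dots,x_m)$ with $x_\alpha\in Mat_n$, and the standard product is $xy=(x_1y_1,\dots,x_my_m)$. A multiplication $\circ$ is called compatible with the standard product if the product $x\bullet y=xy+\lambda\,x\circ y$ is associative for every constant $\lambda$. Sums over $(i,\beta)$ run over $0\le i\le k-1$, $1\le\beta\le m$, omitting the indicated pair. Scalars in expressions with $T$ mean multiples of $\mathbf 1$, and a fraction such as $\frac{T-\lambda_\alpha}{\varepsilon^{-i}T-\lambda_\beta}$ denotes $(T-\lambda_\alpha\mathbf 1)(\varepsilon^{-i}T-\lambda_\beta\mathbf 1)^{-1}$ (the factors commute). *)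

(* Defs.v *)
From HB Require Import structures.
From mathcomp Require Import all_boot all_order all_algebra.
From mathcomp Require Import complex.
From mathcomp Require Import reals sequences trigo.

Set Implicit Arguments.
Unset Strict Implicit.
Unset Printing Implicit Defensive.

Import Order.TTheory GRing.Theory Num.Theory.

Local Open Scope ring_scope.
Local Open Scope complex_scope.

Definition expC (R : realType) (z : R[i]) : R[i] :=
  (expR (complex.Re z))%:C
  * (cos (complex.Im z) +i* sin (complex.Im z)).

Definition eps (R : realType) (k : nat) : R[i] :=
  expC (2 * (pi : R)%:C * 'i / k%:R).

(* The pointwise ring structure of {ffun 'I_m -> _} is the standard product. *)
Notation matpow R m n := {ffun 'I_m -> 'M[R[i]]_n}.

(* [invmx D] is a genuine inverse only if [D \in unitmx]; every D used below
   divides some T^k - lam_alpha^k, which is assumed invertible. *)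
Definition mxfrac (F : fieldType) (n : nat) (N D : 'M[F]_n) : 'M[F]_n :=
  N *m invmx D.

Definition conj_pow (F : fieldType) (n : nat) (B : 'M[F]_n) (i : nat)
    (x : 'M[F]_n) : 'M[F]_n :=
  invmx (B ^+ i) *m x *m B ^+ i.

(* The pair is compared in nat * 'I_m, as 'I_k has no canonical zero. *)
Definition off (k m : nat) (alpha : 'I_m) (p : 'I_k * 'I_m) : bool :=
  (nat_of_ord p.1, p.2) != (0%N, alpha).

Section Product.

Variables (R : realType) (k m n : nat).
Variables (T B : 'M[R[i]]_n) (lam t : 'I_m -> R[i]).

Local Notation e := (eps R k).

Definition twist (alpha : 'I_m) (p : 'I_k * 'I_m) (x : 'M[R[i]]_n) :
    'M[R[i]]_n :=
  mxfrac (T - (lam alpha)%:M) (e ^- p.1 *: T - (lam p.2)%:M)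
  *m conj_pow B p.1 x.

Definition Rop (x : matpow R m n) : matpow R m n :=
  [ffun alpha =>
    \sum_(p : 'I_k * 'I_m | off alpha p)
       (t p.2 / (e ^+ p.1 * lam p.2 - lam alpha)) *: twist alpha p (x p.2)
    + (mxfrac (t alpha)%:M (T - (lam alpha)%:M)
       - (\sum_(p : 'I_k * 'I_m | off alpha p)
            e ^+ p.1 * t p.2 / (e ^+ p.1 * lam p.2 - lam alpha))%:M)
      *m x alpha].

Definition circ (x y : matpow R m n) : matpow R m n :=
  Rop x * y + x * Rop y - Rop (x * y).

Definition circ_explicit (x y : matpow R m n) : matpow R m n :=
  [ffun alpha =>
    \sum_(p : 'I_k * 'I_m | off alpha p)
       (t p.2 / (e ^+ p.1 * lam p.2 - lam alpha)) *:
         (twist alpha p (x p.2) *m y alpha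
          + x alpha *m twist alpha p (y p.2)
          - twist alpha p (x p.2 *m y p.2))
    + t alpha *: (x alpha *m mxfrac 1%:M (T - (lam alpha)%:M) *m y alpha)
    - \sum_(p : 'I_k * 'I_m | off alpha p)
        (e ^+ p.1 * t p.2 / (e ^+ p.1 * lam p.2 - lam alpha)) *:
          (x alpha *m y alpha)].

End Product.

(* A multiplication on a complex vector space is bilinear by definition. *)
Definition associative_product (R : realType) (m n : nat)
    (mu : matpow R m n -> matpow R m n -> matpow R m n) : Prop :=
  [/\ forall y, linear (fun x => mu x y),
      forall x, linear (mu x)
    & associative mu].

Definition compatible (R : realType) (m n : nat)
    (mu : matpow R m n -> matpow R m n -> matpow R m n) : Prop :=
  forall c : R[i],
    associative (fun x y : matpow R m n => x * y + c *: mu x y).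

(* Exactly the nonvanishing of the scalar denominators; no condition on the
   t_alpha is needed. *)
Definition generic (R : realType) (k m : nat) (lam : 'I_m -> R[i]) : Prop :=
  forall (alpha : 'I_m) (p : 'I_k * 'I_m),
    off alpha p -> eps R k ^+ p.1 * lam p.2 - lam alpha != 0.

(* Main.v *)
(* Conjugating by powers of B, i.e. replacing (x_beta) by the family
   x_(i,beta) = B^-i x_beta B^i indexed by p = (i,beta), embeds (Mat_n)^m in
   (Mat_n)^(km) and turns R into the untwisted (k = 1, B = 1) operator with
   nodes mu_p = eps^i lam_beta and weights tau_p = eps^i t_beta.  As
   (T - mu_q)/(T - mu_p) = 1 + (mu_p - mu_q)/(T - mu_p), that operator is
     R(x)_q = sum_(p != q) tau_p/(mu_p - mu_q) (x_p - x_q) + S(x),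
     S(x) = sum_p tau_p/(T - mu_p) x_p,
   with S(x) independent of q.  The resolvent identity gives
   S(x o y) = S(x) S(y), and a partial fraction identity then gives
     (R(x)R(y) - R(x o y))_q
       = - sum_(p != q) tau_p tau_q/(mu_p - mu_q)^2 (x_p - x_q)(y_p - y_q),
   a Hochschild 2-cocycle; this is what the associativity of o requires.
   Compatibility follows because o is itself a Hochschild coboundary. *)

Require Import Defs.
From HB Require Import structures.
From mathcomp Require Import all_boot all_order all_algebra.
From mathcomp Require Import complex.
From mathcomp Require Import reals sequences trigo.
From mathcomp Require Import exp ring.

Set Implicit Arguments.
Unset Strict Implicit.
Unset Printing Implicit Defensive.

Import Order.TTheory GRing.Theory Num.Theory.

Local Open Scope ring_scope.
Local Open Scope complex_scope.

(** * Products deformed by an additive operator, and Hochschild cocycles *)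

Section DeformedProduct.

Variables (A : pzRingType) (R : A -> A).

Definition deformed (x y : A) : A := R x * y + x * R y - R (x * y).

(** The associative Nijenhuis torsion: the defect of [R] as a morphism from the deformed product to
    the standard one. *)
Definition torsion (x y : A) : A := R x * R y - R (deformed x y).

(** [deformed] is the Hochschild coboundary of [R]: the terms R(xy)z cancel on the left, and the
    terms xR(yz) on the right. *)
Lemma deformed_cocycle (x y z : A) :
  deformed x y * z + deformed (x * y) z = x * deformed y z + deformed x (y * z).
Proof.
rewrite /deformed !mulrDl !mulrDr mulNr mulrN !mulrA !addrA; congr (_ - _).
rewrite [LHS](ACl ((3*4)*(1*2*5))%AC)/= addNr add0r.
by rewrite [RHS](ACl ((3*5)*(4*1*2))%AC)/= addNr add0r.
Qed.

(** Each bracketing, once its torsion terms and an R-image are added, becomes R(x)R(y)z + R(x)yR(z)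
    + xR(y)R(z) ([L] and [M]). The added terms agree, by the torsion cocycle identity and by
    [deformed_cocycle]. *)
Lemma deformed_assoc :
  {morph R : x y / x + y} ->
  (forall x y z, torsion x y * z + torsion (x * y) z =
                 x * torsion y z + torsion x (y * z)) ->
  associative deformed.
Proof.
move=> RD cocycle.
have RM x y : R x * R y = R (deformed x y) + torsion x y.
  by rewrite /torsion addrC subrK.
have L x y z : deformed (deformed x y) z + (torsion x y * z + torsion (x * y) z)
   + R (deformed x y * z + deformed (x * y) z) =
   R x * R y * z + R x * y * R z + x * R y * R z.
  rewrite RD RM [deformed (deformed x y) z]/deformed.
  have -> : deformed x y * R z =
      R x * y * R z + x * R y * R z
      - R (deformed (x * y) z) - torsion (x * y) z.
    by rewrite /deformed !mulrDl mulNr RM -/(deformed _ _) opprD !addrA.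
  move: (torsion x y) (torsion (x * y) z) => u v.
  rewrite [(_ + u) * z]mulrDl !addrA.
  by rewrite [LHS](ACl ((1*7*2*3)*(4*10)*(5*8)*(6*9))%AC)/= !addNr !addr0.
have M x y z : deformed x (deformed y z) + (x * torsion y z + torsion x (y * z))
   + R (x * deformed y z + deformed x (y * z)) =
   R x * R y * z + R x * y * R z + x * R y * R z.
  rewrite RD -[R x * R y * z]mulrA -[x * R y * R z]mulrA RM.
  rewrite [deformed x (deformed y z)]/deformed.
  have -> : R x * deformed y z = R x * (R y * z) + R x * y * R z
      - R (deformed x (y * z)) - torsion x (y * z).
    by rewrite /deformed !mulrDr mulrN RM -/(deformed _ _) opprD !mulrA !addrA.
  move: (torsion y z) (torsion x (y * z)) => u v.
  rewrite [x * (_ + u)]mulrDr !addrA.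
  by rewrite [LHS](ACl ((1*2*5*7)*(3*10)*(4*8)*(6*9))%AC)/= !addNr !addr0.
move=> x y z; apply: (addIr (torsion x y * z + torsion (x * y) z)).
apply: (addIr (R (deformed x y * z + deformed (x * y) z))).
by rewrite L cocycle deformed_cocycle M.
Qed.

End DeformedProduct.

Lemma antisym_sum_eq0 (F : numFieldType) (V : lmodType F) (P : finType)
    (f : P -> P -> V) :
  (forall p r, f p r + f r p = 0) -> \sum_p \sum_r f p r = 0.
Proof.
move=> f_antisym; set s := LHS.
have: s + s = 0.
  rewrite {2}/s exchange_big /= /s -big_split /= big1 // => p _.
  by rewrite -big_split /= big1.
by rewrite -mulr2n -scaler_nat => /eqP; rewrite scaler_eq0 pnatr_eq0 => /eqP.
Qed.

(* ['M_n] has no canonical algebra structure when [n] is not a successor, so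
   [scalerAl] and [scalerAr] do not apply. *)
Lemma scale_mulmxl (F : fieldType) n (a : F) (x y : 'M[F]_n) :
  (a *: x) * y = a *: (x * y).
Proof. exact: esym (scalemxAl a x y). Qed.

Lemma scale_mulmxr (F : fieldType) n (a : F) (x y : 'M[F]_n) :
  x * (a *: y) = a *: (x * y).
Proof. exact: esym (scalemxAr a x y). Qed.

Lemma scale_ffun_mulmxl (F : fieldType) (P : finType) n (a : F)
    (x y : {ffun P -> 'M[F]_n}) : (a *: x) * y = a *: (x * y).
Proof. by apply/ffunP => p; rewrite !ffunE scale_mulmxl. Qed.

Lemma scale_ffun_mulmxr (F : fieldType) (P : finType) n (a : F)
    (x y : {ffun P -> 'M[F]_n}) : x * (a *: y) = a *: (x * y).
Proof. by apply/ffunP => p; rewrite !ffunE scale_mulmxr. Qed.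

(** * Bilinearity and compatibility for a linear operator *)

Section LinearDeformation.

Variables (F : fieldType) (P : finType) (n : nat).
Local Notation A := {ffun P -> 'M[F]_n}.
Variable R : A -> A.
Hypothesis R_linear : linear R.

Lemma deformed_linearl (y : A) : linear (deformed R ^~ y).
Proof.
move=> a u v; rewrite /deformed !mulrDl !scale_ffun_mulmxl !R_linear !mulrDl.
rewrite !scale_ffun_mulmxl !scalerDr scalerN opprD !addrA.
by rewrite [LHS](ACl (1*3*5*2*4*6)%AC).
Qed.

Lemma deformed_linearr (x : A) : linear (deformed R x).
Proof.
move=> a u v; rewrite /deformed !mulrDr !scale_ffun_mulmxr !R_linear !mulrDr.
rewrite !scale_ffun_mulmxr !scalerDr scalerN opprD !addrA.
by rewrite [LHS](ACl (1*3*5*2*4*6)%AC).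
Qed.

(** By powers of c, the coefficients are associativity of the standard product, the cocycle
    identity, and associativity of the deformed product. *)
Lemma deformed_compatible (c : F) :
  associative (deformed R) ->
  associative (fun x y : A => x * y + c *: deformed R x y).
Proof.
move=> assoc x y z.
have -> : deformed R x (y * z + c *: deformed R y z) =
    deformed R x (y * z) + c *: deformed R x (deformed R y z).
  by rewrite addrC deformed_linearr addrC.
have -> : deformed R (x * y + c *: deformed R x y) z =
    deformed R (x * y) z + c *: deformed R (deformed R x y) z.
  by rewrite addrC deformed_linearl addrC.
rewrite mulrDl mulrDr scale_ffun_mulmxl scale_ffun_mulmxr mulrA assoc.
have := deformed_cocycle R x y z.
move: (deformed R (deformed R x y) z) (deformed R (x * y) z).
move: (deformed R x (y * z)) (deformed R x y) (deformed R y z) => u v w r s E.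
rewrite !scalerDr -!addrA; congr (_ + _).
by rewrite !addrA -!scalerDr E.
Qed.

End LinearDeformation.

(** * The untwisted operator with distinct nodes and abstract resolvents *)

Section CauchyDeformation.

Variables (F : numFieldType) (P : finType) (n : nat).
Variables (mu tau : P -> F) (D : P -> 'M[F]_n).
Hypothesis mu_inj : injective mu.
Hypothesis resolvent : forall p q, D p - D q = (mu p - mu q) *: (D p * D q).

Local Notation A := {ffun P -> 'M[F]_n}.

(* At [p = q] the division by 0 gives the junk value 0, so sums over all [p]
   agree with the sums over [p != q]. *)
Definition cauchy (p q : P) : F := tau p / (mu p - mu q).

Definition resolvent_sum (x : A) : 'M[F]_n := \sum_p tau p *: (D p * x p).

Definition cauchy_op (x : A) : A :=
  [ffun q => \sum_p cauchy p q *: (x p - x q) + resolvent_sum x].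

(** Exchanging p and q in the resolvent identity changes the sign of both the left side and the
    scalar factor. *)
Lemma resolventC p q : D p * D q = D q * D p.
Proof.
have [-> //|neq_pq] := eqVneq p q.
have mu_neq : mu p - mu q != 0 by rewrite subr_eq0 (inj_eq mu_inj).
apply: (scalerI mu_neq); rewrite -resolvent -[RHS]opprK -scaleNr opprB.
by rewrite -resolvent opprB.
Qed.

Lemma cauchy_diag p : cauchy p p = 0.
Proof. by rewrite /cauchy subrr invr0 mulr0. Qed.

Lemma resolvent_sum_linear : linear resolvent_sum.
Proof.
move=> a x y; rewrite /resolvent_sum scaler_sumr -big_split /=.
apply: eq_bigr => p _; rewrite !ffunE mulrDr scale_mulmxr scalerDr.
by rewrite !scalerA mulrC.
Qed.

Lemma cauchy_op_linear : linear cauchy_op.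
Proof.
move=> a x y; apply/ffunP => q; rewrite !ffunE resolvent_sum_linear scalerDr.
rewrite addrACA; congr (_ + _); rewrite scaler_sumr -big_split /=.
apply: eq_bigr => p _; rewrite !ffunE opprD addrACA -scalerBr scalerDr.
by rewrite !scalerA mulrC.
Qed.

Local Notation circ := (deformed cauchy_op).

(** For d(x) = x_p - x_q one has d(x) y_q + x_q d(y) - d(xy) = - d(x) d(y). *)
Lemma deformed_cauchyE (x y : A) q :
  circ x y q = - (\sum_p cauchy p q *: ((x p - x q) * (y p - y q)))
    + resolvent_sum x * y q + x q * resolvent_sum y - resolvent_sum (x * y).
Proof.
rewrite /deformed !ffunE mulrDl mulrDr opprD !addrA; congr (_ - _).
rewrite [LHS](ACl ((1*3*5)*2*4)%AC)/=; do 2!congr (_ + _).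
rewrite mulr_suml mulr_sumr -big_split -!sumrN -big_split /=.
apply: eq_bigr => p _; rewrite !ffunE scale_mulmxl scale_mulmxr.
rewrite -scalerDr -scalerBr -scalerN; congr (_ *: _).
rewrite !mulrBl !mulrBr.
move: (x p * y p) (x p * y q) (x q * y p) (x q * y q) => a b c d.
by apply/matrixP => i j; rewrite !mxE; ring.
Qed.

Lemma resolvent_sumM (x y : A) :
  resolvent_sum (circ x y) = resolvent_sum x * resolvent_sum y.
Proof.
(* The difference of the two sides is a double sum that the resolvent identity
   makes antisymmetric. *)
pose f q p : 'M[F]_n := tau q *: (D q * (tau p *: (D p * x p * (y q - y p))
  - cauchy p q *: ((x p - x q) * (y p - y q)))).
suff E : resolvent_sum (circ x y) = resolvent_sum x * resolvent_sum y
    + \sum_q \sum_p f q p.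
  rewrite E antisym_sum_eq0 ?addr0 // => q p; rewrite /f.
  have [->|neq_pq] := eqVneq p q.
    by rewrite cauchy_diag !subrr !mulr0 !scaler0 subrr mulr0 scaler0 addr0.
  have mu_neq : mu p - mu q != 0 by rewrite subr_eq0 (inj_eq mu_inj).
  (* Splitting the product of resolvents leaves each resolvent alone on the left of a monomial in x
     and y, so only scalar coefficients have to be compared. *)
  have DD : D p * D q = (mu p - mu q)^-1 *: (D p - D q).
    by rewrite resolvent scalerA mulVf ?scale1r.
  rewrite [D q * (_ - _)]mulrBr [D p * (_ - _)]mulrBr !scale_mulmxr !mulrA.
  rewrite (resolventC q p) DD /cauchy !(mulrBl, mulrBr, scale_mulmxl).
  move: (D p * x p * y p) (D p * x p * y q) (D p * x q * y p) (D p * x q * y q)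
    (D q * x p * y p) (D q * x p * y q) (D q * x q * y p) (D q * x q * y q).
  move=> *; apply/matrixP => i j; rewrite !mxE; field.
  by rewrite -oppr_eq0 opprB mu_neq.
(* The term x_q S(y) of the product already sums to S(x)S(y); all other terms are collected in
   [f]. *)
rewrite /resolvent_sum mulr_suml -big_split /=; apply: eq_bigr => q _.
rewrite deformed_cauchyE -scaler_sumr -mulr_sumr sumrB.
rewrite scale_mulmxl -mulrA -[RHS]scalerDr -[in RHS]mulrDr.
congr (_ *: _); congr (_ * _); rewrite -/(resolvent_sum y) addrC !addrA.
rewrite [LHS](ACl (4*(3*1)*2)%AC)/=; congr (_ - _); congr (_ + _).
rewrite /resolvent_sum mulr_suml -sumrB; apply: eq_bigr => p _.
by rewrite scale_mulmxl -scalerBr mulrBr ffunE mulrA.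
Qed.

(** In the differences [a], [b] from the values at q, the resolvent sums cancel by [resolvent_sumM]
    and the torsion becomes [La * Lb - Z]. Subtracting the claimed sum leaves an antisymmetric
    double sum. *)
Lemma torsion_cauchyE (x y : A) q :
  torsion cauchy_op x y q =
    \sum_p (cauchy p q * cauchy q p) *: ((x p - x q) * (y p - y q)).
Proof.
pose a p : 'M[F]_n := x p - x q; pose b p : 'M[F]_n := y p - y q.
(* The claimed sum is subtracted at r = q, where it cancels the rest of the summand; the partial
   fraction identity is then only needed for distinct p, q, r. *)
pose g p r : 'M[F]_n := cauchy p q *: (cauchy r q *: (a p * b r - a r * b r)
  + cauchy r p *: ((a r - a p) * (b r - b p)))
  - (if r == q then (cauchy p q * cauchy q p) *: (a p * b p) else 0).
(* [1/(p-q)(r-p) + 1/(r-q)(p-r) = 1/(p-q)(r-q)], with the nodes abbreviated. *)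
have g_sum : \sum_p \sum_r g p r = 0.
  apply: antisym_sum_eq0 => p r; rewrite /g.
  have aq : a q = 0 by rewrite /a subrr.
  have bq : b q = 0 by rewrite /b subrr.
  have [->|neq_rq] := eqVneq r q; have [->|neq_pq] := eqVneq p q.
  - by rewrite cauchy_diag !scale0r mul0r scale0r subrr addr0.
  - rewrite cauchy_diag aq bq !scale0r !add0r mulrNN scalerA subrr.
    by rewrite oppr0 addr0.
  - rewrite cauchy_diag aq bq !scale0r oppr0 !add0r mulrNN scalerA.
    by rewrite subrr.
  have [->|neq_pr] := eqVneq p r.
    by rewrite cauchy_diag !subrr !scale0r scaler0 oppr0 !addr0 !scaler0 ?addr0.
  have mu_neq u v : u != v -> mu u - mu v != 0.
    by move=> neq_uv; rewrite subr_eq0 (inj_eq mu_inj).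
  move: (a p) (a r) (b p) (b r) => ap ar bp br.
  rewrite /cauchy subr0 oppr0 addr0 !(mulrBl, mulrBr).
  move: (ap * bp) (ap * br) (ar * bp) (ar * br) => *.
  apply/matrixP => i j; rewrite !mxE; field.
  by rewrite !mu_neq // eq_sym.
pose La : 'M[F]_n := \sum_p cauchy p q *: a p.
pose Lb : 'M[F]_n := \sum_p cauchy p q *: b p.
pose Z : 'M[F]_n := \sum_p cauchy p q *: (\sum_r (cauchy r q *: (a r * b r)
  - cauchy r p *: ((a r - a p) * (b r - b p)))).
(* The term S(xy) is the same at every node and drops out of the difference. *)
have circB p : circ x y p - circ x y q =
    \sum_r (cauchy r q *: (a r * b r)
      - cauchy r p *: ((a r - a p) * (b r - b p)))
    + resolvent_sum x * b p + a p * resolvent_sum y.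
  rewrite sumrB !deformed_cauchyE opprB addrA subrK mulrBl mulrBr.
  under [\sum_r cauchy r p *: ((a r - a p) * _)]eq_bigr => r _.
    rewrite {1}/a {1}/a {1}/b {1}/b !opprB [x r - x q + _]addrA subrK.
    rewrite [y r - y q + _]addrA subrK.
  over.
  move: (\sum_p0 _) (\sum_r _) => u v.
  move: (_ * y p) (_ * y q) (x p * _) (x q * _) => *.
  by apply/matrixP => i j; rewrite !mxE; ring.
have E1 : torsion cauchy_op x y q = La * Lb - Z.
  have opE u : cauchy_op u q =
      \sum_p cauchy p q *: (u p - u q) + resolvent_sum u by rewrite ffunE.
  have -> : torsion cauchy_op x y q =
      cauchy_op x q * cauchy_op y q - cauchy_op (circ x y) q.
    rewrite /torsion; move: (cauchy_op x) (cauchy_op y) (cauchy_op _) => u v w.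
    by rewrite !ffunE.
  rewrite !opE resolvent_sumM -/La -/Lb.
  have -> : \sum_p cauchy p q *: (circ x y p - circ x y q) =
      Z + resolvent_sum x * Lb + La * resolvent_sum y.
    rewrite /Z /La /Lb mulr_sumr mulr_suml -!big_split /=.
    apply: eq_bigr => p _.
    by rewrite circB scale_mulmxl scale_mulmxr 2!scalerDr.
  rewrite !mulrDl !mulrDr.
  move: (La * Lb) (resolvent_sum x * Lb) (La * resolvent_sum y) => u v w.
  move: (resolvent_sum x * resolvent_sum y) => z.
  by apply/matrixP => i j; rewrite !mxE; ring.
rewrite E1; apply/eqP; rewrite -subr_eq0; apply/eqP; rewrite -[RHS]g_sum.
rewrite /La /Z mulr_suml -!sumrB; apply: eq_bigr => p _.
rewrite /g [RHS]sumrB -big_mkcond /= big_pred1_eq; congr (_ - _).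
rewrite -scaler_sumr scale_mulmxl -scalerBr; congr (_ *: _).
rewrite /Lb mulr_sumr -sumrB; apply: eq_bigr => r _.
by rewrite scale_mulmxr scalerBr opprB addrA addrAC.
Qed.

(** Up to sign, each (x_p - x_q)(y_p - y_q) is the coboundary of x_p - x_q, with both actions
    through the component at q. *)
Lemma torsion_cauchy_cocycle (x y z : A) :
  torsion cauchy_op x y * z + torsion cauchy_op (x * y) z =
  x * torsion cauchy_op y z + torsion cauchy_op x (y * z).
Proof.
have evalMD (u v w : A) q : (u * v + w) q = u q * v q + w q by rewrite !ffunE.
move: (torsion cauchy_op) torsion_cauchyE => N NE; apply/ffunP => q.
rewrite !evalMD !NE mulr_suml mulr_sumr -!big_split /=; apply: eq_bigr => p _.
rewrite scale_mulmxl scale_mulmxr -!scalerDr !ffunE; congr (_ *: _).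
rewrite !(mulrBl, mulrBr) !mulrA.
move: (x p * y p * z p) (x p * y p * z q) (x p * y q * z q) (x q * y p * z p)
  (x q * y p * z q) (x q * y q * z p) (x q * y q * z q).
by move=> *; apply/matrixP => i j; rewrite !mxE; ring.
Qed.

Lemma deformed_cauchy_assoc : associative circ.
Proof.
apply: deformed_assoc torsion_cauchy_cocycle => x y.
by rewrite -[x]scale1r cauchy_op_linear !scale1r.
Qed.

End CauchyDeformation.

(** * De Moivre's formula and the root of unity *)

Lemma cos_sin_expr (R : realType) (a : R) (j : nat) :
  (cos a +i* sin a) ^+ j = cos (a *+ j) +i* sin (a *+ j).
Proof.
elim: j => [|j IHj]; first by rewrite expr0 mulr0n cos0 sin0.
rewrite exprS IHj mulrS cosD sinD; simpc.
by rewrite [sin a * _ + _]addrC.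
Qed.

Lemma eps_exprk (R : realType) (k : nat) : (0 < k)%N -> eps R k ^+ k = 1.
Proof.
move=> k_gt0; have k_neq0 : k%:R != 0 :> R by rewrite pnatr_eq0 -lt0n.
have -> : eps R k = cos (2 * pi / k%:R) +i* sin (2 * pi / k%:R).
  rewrite /eps /expC.
  have -> : 2 * (pi : R)%:C * 'i / k%:R = 0 +i* (2 * pi / k%:R) :> R[i].
    have -> : (k%:R : R[i]) = (k%:R : R)%:C by rewrite rmorph_nat.
    have -> : (2 : R[i]) = (2 : R)%:C by rewrite rmorph_nat.
    rewrite -fmorphV -[X in X = _]mulrA [_ * _ ^-1%:C]mulrC mulrA -!rmorphM /=.
    by simpc.
  by rewrite /= expR0 mul1r.
rewrite cos_sin_expr -[_ *+ k]mulr_natr divfK // mulr_natl.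
by rewrite cos2pi sin2pi.
Qed.

(** * Conjugation by powers of a matrix of finite order *)

Lemma conj_pow_linear (F : fieldType) n (B : 'M[F]_n) i : linear (conj_pow B i).
Proof.
by move=> a x y; rewrite /conj_pow mulmxDr mulmxDl -scalemxAr -scalemxAl.
Qed.

HB.instance Definition _ (F : fieldType) n (B : 'M[F]_n) i :=
  GRing.isLinear.Build F _ _ _ _ (conj_pow_linear B i).

Section CyclicConjugation.

Variables (F : fieldType) (k n : nat) (B : 'M[F]_n).
Hypothesis k_gt0 : (0 < k)%N.
Hypothesis B_exprk : B ^+ k = 1%:M.

(** Since (k-1)i + i = ki, the inverse of a power of B is again a power with natural exponent, which
    replaces [invmx] in [conj_powE]. *)
Lemma mul_exprVl i : B ^+ (k.-1 * i) * B ^+ i = 1.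
Proof.
rewrite -exprD addnC -mulSn prednK // exprM B_exprk; exact: expr1n.
Qed.

Lemma mul_exprVr i : B ^+ i * B ^+ (k.-1 * i) = 1.
Proof. by rewrite -exprD addnC exprD mul_exprVl. Qed.

Lemma conj_powE i (x : 'M[F]_n) :
  conj_pow B i x = B ^+ (k.-1 * i) * x * B ^+ i.
Proof.
have BV : B ^+ (k.-1 * i) *m B ^+ i = 1%:M := mul_exprVl i.
have [_ Bi_unit] := mulmx1_unit BV.
by rewrite /conj_pow -[invmx _]mul1mx -BV mulmxK.
Qed.

Lemma conj_pow0 (x : 'M[F]_n) : conj_pow B 0 x = x.
Proof. by rewrite conj_powE muln0 expr0 mul1r mulr1. Qed.

Lemma conj_powD i j (x : 'M[F]_n) :
  conj_pow B (i + j) x = conj_pow B j (conj_pow B i x).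
Proof. by rewrite !conj_powE mulnDr [(k.-1 * i + _)%N]addnC !exprD !mulrA. Qed.

Lemma conj_pow_mod i (x : 'M[F]_n) : conj_pow B (i %% k) x = conj_pow B i x.
Proof.
rewrite !conj_powE !(expr_mod _ B_exprk) -[in LHS](expr_mod _ B_exprk).
by rewrite modnMmr expr_mod.
Qed.

Lemma conj_powM i (x y : 'M[F]_n) :
  conj_pow B i (x * y) = conj_pow B i x * conj_pow B i y.
Proof.
rewrite !conj_powE !mulrA -[X in _ = X * y * _]mulrA mul_exprVr.
by rewrite mulr1.
Qed.

Lemma conj_pow1 i : conj_pow B i 1 = 1.
Proof. by rewrite conj_powE mulr1 mul_exprVl. Qed.

End CyclicConjugation.

(** * Twisted nodes and the equivariant embedding *)

Definition twisted (F : fieldType) k m (e : F) (c : 'I_m -> F)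
    (p : 'I_k * 'I_m) : F := e ^+ p.1 * c p.2.

Section TwistedPoints.

Variables (F : numFieldType) (k m n : nat) (e : F).
Variables (T B : 'M[F]_n) (lam t : 'I_m -> F).
Hypothesis k_gt0 : (0 < k)%N.
Hypothesis e_exprk : e ^+ k = 1.
Hypothesis B_exprk : B ^+ k = 1%:M.
Hypothesis mulBT : B *m T = e *: (T *m B).
Hypothesis lam_generic : forall (a : 'I_m) (p : 'I_k * 'I_m),
  off a p -> e ^+ p.1 * lam p.2 - lam a != 0.
Hypothesis T_unit : forall a, T ^+ k - (lam a ^+ k)%:M \in unitmx.

Local Notation P := ('I_k * 'I_m)%type.
Local Notation mu := (@twisted F k m e lam).
Local Notation tau := (@twisted F k m e t).

Definition twisted_resolvent (p : P) : 'M[F]_n := invmx (T - (mu p)%:M).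

Definition twisted_lift (x : {ffun 'I_m -> 'M[F]_n}) : {ffun P -> 'M[F]_n} :=
  [ffun p : P => conj_pow B p.1 (x p.2)].

(** The action of Z/k on the nodes; the image of [lift] is equivariant for it and for conjugation by
    powers of B. *)
Definition twisted_shift j (p : P) : P :=
  (Ordinal (ltn_pmod (p.1 + j) k_gt0), p.2).

Local Notation D := twisted_resolvent.
Local Notation lift := twisted_lift.
Local Notation shift := twisted_shift.
Local Notation op := (cauchy_op mu tau D).

(** [Rop] for a general root of unity [e]; the body matches so that the two are convertible at
    [eps]. *)
Definition twisted_op (x : {ffun 'I_m -> 'M[F]_n}) : {ffun 'I_m -> 'M[F]_n} :=
  [ffun a =>
    \sum_(p : P | off a p) (t p.2 / (e ^+ p.1 * lam p.2 - lam a)) *: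
        (mxfrac (T - (lam a)%:M) (e ^- p.1 *: T - (lam p.2)%:M)
          *m conj_pow B p.1 (x p.2))
    + (mxfrac (t a)%:M (T - (lam a)%:M)
        - (\sum_(p : P | off a p)
             e ^+ p.1 * t p.2 / (e ^+ p.1 * lam p.2 - lam a))%:M) *m x a].

Lemma twisted_op_linear : linear twisted_op.
Proof.
move=> c x y; apply/ffunP => a; rewrite !ffunE mulmxDr -scalemxAr.
rewrite scalerDr addrACA; congr (_ + _).
rewrite scaler_sumr -big_split /=; apply: eq_bigr => p _.
by rewrite !ffunE linearP mulmxDr -scalemxAr scalerDr !scalerA mulrC.
Qed.

Lemma expr_root_neq0 i : e ^+ i != 0.
Proof.
apply: contra_eq_neq e_exprk => /eqP; rewrite expf_eq0 => /andP[_ /eqP ->].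
by rewrite expr0n gtn_eqF // eq_sym oner_eq0.
Qed.

(** The kth power of mu_p is that of [lam p.2], so T - mu_p divides the invertible T^k - lam^k. *)
Lemma twisted_resolvent_unit p : T - (mu p)%:M \in unitmx.
Proof.
have comm_T : GRing.comm T (mu p)%:M by exact: comm_mx_scalar.
have := T_unit p.2.
have -> : (lam p.2 ^+ k)%:M = (mu p)%:M ^+ k :> 'M_n.
  by rewrite -rmorphXn /= exprMn exprAC e_exprk // expr1n mul1r.
by rewrite subrXX_comm // [_ * _ \in _]unitmx_mul => /andP[].
Qed.

Lemma twisted_resolvent_identity p q : D p - D q = (mu p - mu q) *: (D p * D q).
Proof.
have uq := twisted_resolvent_unit q; have up := twisted_resolvent_unit p.
(* D_p - D_q = D_p ((T - mu_q) - (T - mu_p)) D_q. *)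
rewrite -[D p in LHS]mulmx1 -(mulmxV uq) mulmxA -[X in _ - X]mul1mx.
rewrite -(mulVmx up) -mulmxBl -mulmxBr opprB addrC addrA subrK -raddfB.
by rewrite [_ *m _%:M]scalar_mxC mul_scalar_mx -scalemxAl.
Qed.

Lemma conj_powT i : conj_pow B i T = e ^- i *: T.
Proof.
have mulBiT : B ^+ i * T = e ^+ i *: (T * B ^+ i).
  elim: i => [|i IHi]; first by rewrite !expr0 mul1r mulr1 scale1r.
  rewrite exprSr -mulrA [B * T]mulBT scale_mulmxr [B ^+ i * (T *m B)]mulrA IHi.
  by rewrite scale_mulmxl scalerA -exprS -[T * B ^+ i * B]mulrA.
have ei := expr_root_neq0 i.
rewrite (conj_powE k_gt0 B_exprk); apply: (scalerI ei).
rewrite scalerA divff // scale1r -mulrA -scale_mulmxr -mulBiT mulrA.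
by rewrite mul_exprVl // mul1r.
Qed.

Lemma twisted_shift_inj j : injective (shift j).
Proof.
move=> [i a] [i' a'] [] /eqP; rewrite eqn_modDr => /eqP + ->.
by rewrite !modn_small // => /val_inj ->.
Qed.

Lemma twisted_shiftE (c : 'I_m -> F) j p :
  twisted e c (shift j p) = e ^+ j * twisted e c p.
Proof. by rewrite /twisted /= expr_mod // addnC exprD mulrA. Qed.

(** Genericity only compares a node with those of index i = 0, so both nodes are first multiplied by
    e^(k-i'), which moves the second one to [lam a']. *)
Lemma twisted_inj : injective mu.
Proof.
move=> [i a] [i' a'] mu_eq.
have e_shift : e ^+ (k - i') * e ^+ i' = 1.
  by rewrite -exprD subnK ?e_exprk // ltnW.
have := @lam_generic a' (shift (k - i') (i, a)).
case: (boolP (off _ _)) => [_ /(_ isT)|].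
  by rewrite -/(mu _) twisted_shiftE mu_eq /twisted mulrA e_shift mul1r subrr
    eqxx.
rewrite negbK => /eqP[ik ->] _; congr (_, _); apply: val_inj => /=.
rewrite -(modn_small (ltn_ord i)) -(modn_small (ltn_ord i')).
apply/eqP; rewrite -(eqn_modDr (k - i')) ik subnKC ?modnn //.
by rewrite ltnW.
Qed.

Lemma cauchy_shift j p q :
  cauchy mu tau (shift j p) (shift j q) = cauchy mu tau p q.
Proof.
rewrite /cauchy !twisted_shiftE -mulrBr -mulf_div divff ?mul1r //.
exact: expr_root_neq0.
Qed.

(** Conjugation sends T - mu_p to e^-j (T - e^j mu_p), and e^j mu_p is the shifted node; then
    invert. *)
Lemma conj_twisted_resolvent j p : conj_pow B j (D p) = e ^+ j *: D (shift j p).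
Proof.
have ej := expr_root_neq0 j.
have uS := twisted_resolvent_unit (shift j p).
have uP := twisted_resolvent_unit p.
have conjD : conj_pow B j (T - (mu p)%:M) = e ^- j *: (T - (mu (shift j p))%:M).
  rewrite linearB /= conj_powT twisted_shiftE -scalemx1 linearZ /=.
  rewrite (conj_pow1 k_gt0 B_exprk) scalerBr !scale_scalar_mx mulKf //.
  by rewrite mulr1.
have : conj_pow B j (D p) * conj_pow B j (T - (mu p)%:M) = 1.
  rewrite -(conj_powM k_gt0 B_exprk) [_ * _]mulVmx //.
  exact: conj_pow1 k_gt0 B_exprk j.
rewrite conjD scale_mulmxr.
move/(congr1 (fun M => e ^+ j *: (M *m D (shift j p)))).
by rewrite -scalemxAl scalerA divff // scale1r mulmxK // mul1mx.
Qed.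

Lemma twisted_liftM : {morph lift : x y / x * y}.
Proof.
by move=> x y; apply/ffunP => p; rewrite !ffunE (conj_powM k_gt0 B_exprk).
Qed.

Lemma twisted_lift_linear : linear lift.
Proof. by move=> a x y; apply/ffunP => p; rewrite !ffunE linearP. Qed.

Lemma twisted_lift_inj : injective lift.
Proof.
move=> x y /ffunP eq_xy; apply/ffunP => a.
have := eq_xy (Ordinal k_gt0, a); rewrite !ffunE /=.
by rewrite !(conj_pow0 k_gt0 B_exprk).
Qed.

Lemma twisted_lift_shift x j p : lift x (shift j p) = conj_pow B j (lift x p).
Proof.
by rewrite !ffunE (conj_pow_mod k_gt0 B_exprk) (conj_powD k_gt0 B_exprk).
Qed.

(** Both sums are reindexed by the shift. The Cauchy coefficients are invariant, and the factor e^j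
    of the conjugated resolvent is the one the shifted weight acquires. *)
Lemma cauchy_op_lift_shift x j q :
  op (lift x) (shift j q) = conj_pow B j (op (lift x) q).
Proof.
rewrite [LHS]ffunE [op _ q]ffunE /resolvent_sum linearD !linear_sum /=.
rewrite [X in X + _ = _](reindex_inj (@twisted_shift_inj j)).
rewrite [X in _ + X = _](reindex_inj (@twisted_shift_inj j)) /=.
congr (_ + _); apply: eq_bigr => p _.
  rewrite cauchy_shift !twisted_lift_shift linearZ /=.
  by rewrite [conj_pow _ _ (_ - _)]linearB.
rewrite twisted_lift_shift twisted_shiftE linearZ /=.
rewrite (conj_powM k_gt0 B_exprk) conj_twisted_resolvent.
by rewrite scale_mulmxl scalerA [tau p * _]mulrC.
Qed.

Lemma off_neqE (a : 'I_m) (p : P) : off a p = (p != (Ordinal k_gt0, a)).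
Proof. by case: p => i b; rewrite /off !xpair_eqE. Qed.

(** The fraction equals e^i (T - lam_a)/(T - mu_p) = e^i (1 + (mu_p - lam_a) D_p). *)
Lemma mxfrac_conj_powE a (p : P) (x : 'M[F]_n) :
  mxfrac (T - (lam a)%:M) (e ^- p.1 *: T - (lam p.2)%:M) *m conj_pow B p.1 x =
  e ^+ p.1 *: (conj_pow B p.1 x + (mu p - lam a) *: (D p * conj_pow B p.1 x)).
Proof.
have uP := twisted_resolvent_unit p; have ei := expr_root_neq0 p.1.
rewrite /mxfrac.
have -> : e ^- p.1 *: T - (lam p.2)%:M = e ^- p.1 *: (T - (mu p)%:M).
  by rewrite scalerBr scale_scalar_mx mulKf.
have -> : T - (lam a)%:M = (T - (mu p)%:M) + (mu p - lam a)%:M.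
  by rewrite raddfB addrA subrK.
rewrite invmxZ ?unitmxZ ?unitfE ?invr_eq0 // invrK -scalemxAr -scalemxAl.
by rewrite mulmxDl mulmxV // mulmxDl mul1mx mul_scalar_mx -scalemxAl.
Qed.

(** In the coefficient of x_a, the resolvent term is the missing summand p = q of the resolvent sum,
    and the scalar sum supplies the -x_q of the differences. *)
Lemma twisted_opE x a : twisted_op x a = op (lift x) (Ordinal k_gt0, a).
Proof.
rewrite [LHS]ffunE.
pose q : P := (Ordinal k_gt0, a).
have mu0 : mu q = lam a by rewrite /twisted /= expr0 mul1r.
have lift0 : lift x q = x a by rewrite ffunE (conj_pow0 k_gt0 B_exprk).
rewrite !(eq_bigl _ _ (off_neqE a)) -/q.
have -> : \sum_(p | p != q) (t p.2 / (e ^+ p.1 * lam p.2 - lam a)) *: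
      (mxfrac (T - (lam a)%:M) (e ^- p.1 *: T - (lam p.2)%:M)
        *m conj_pow B p.1 (x p.2)) =
    \sum_(p | p != q)
      (cauchy mu tau p q *: lift x p + tau p *: (D p * lift x p)).
  apply: eq_bigr => p neq_pq.
  have mu_neq : mu p - lam a != 0 by rewrite -mu0 subr_eq0 (inj_eq twisted_inj).
  rewrite mxfrac_conj_powE !scalerDr !scalerA ffunE /cauchy mu0 -/(mu p).
  congr (_ *: _ + _ *: _).
    by rewrite mulrC mulrA.
  by rewrite -mulrA mulrCA divfK // /twisted mulrC.
have -> : \sum_(p | p != q) e ^+ p.1 * t p.2 / (e ^+ p.1 * lam p.2 - lam a) =
    \sum_(p | p != q) cauchy mu tau p q.
  by apply: eq_bigr => p _; rewrite /cauchy mu0.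
rewrite [RHS]ffunE /resolvent_sum [X in _ = X + _](bigD1 q) //=.
rewrite cauchy_diag scale0r add0r [X in _ = _ + X](bigD1 q) //= lift0.
under [X in _ = X + _]eq_bigr do rewrite scalerBr.
rewrite [X in _ = X + _]sumrB -scaler_suml [X in X + _ = _]big_split /=.
have tau0 : tau q = t a by rewrite /twisted /= expr0 mul1r.
rewrite /mxfrac mul_scalar_mx mulmxBl mul_scalar_mx -scalemxAl /D mu0 tau0.
by rewrite !addrA [RHS](ACl (1*4*3*2)%AC).
Qed.

(** Every node (j, a) is the shift by j of (0, a), where [twisted_opE] applies; equivariance gives
    the rest. *)
Lemma twisted_lift_op x : lift (twisted_op x) = op (lift x).
Proof.
apply/ffunP => -[j a]; rewrite ffunE /= twisted_opE -cauchy_op_lift_shift.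
by congr (op _ (_, _)); apply: val_inj; rewrite /= add0n modn_small.
Qed.

(** [lift] is injective and carries the deformed product to the untwisted one, so associativity
    pulls back. *)
Lemma deformed_twisted_assoc : associative (deformed twisted_op).
Proof.
have liftB : {morph lift : x y / x - y}.
  by move=> x y; rewrite addrC -scaleN1r twisted_lift_linear scaleN1r addrC.
have liftD : {morph lift : x y / x + y}.
  by move=> x y; rewrite -[x in LHS]scale1r twisted_lift_linear scale1r.
have lift_deformed x y :
    lift (deformed twisted_op x y) = deformed op (lift x) (lift y).
  rewrite /deformed liftB liftD !twisted_liftM !twisted_lift_op.
  by rewrite twisted_liftM.
move=> x y z; apply: twisted_lift_inj; rewrite !lift_deformed.
exact: (deformed_cauchy_assoc _ twisted_inj twisted_resolvent_identity).
Qed.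

End TwistedPoints.

(** * The explicit formula and the conclusion *)

(** One component of the product. In the diagonal part Jxy cancels, leaving xJy, and the scalar w0
    survives once, with a minus sign. *)
Lemma deformed_sumE (F : fieldType) (P : finType) n (S : pred P)
    (c s : P -> F) (u v w : P -> 'M[F]_n) (J x y : 'M[F]_n) :
  let w0 := (\sum_(p | S p) s p)%:M in
  (\sum_(p | S p) c p *: u p + (J - w0) *m x) *m y
    + x *m (\sum_(p | S p) c p *: v p + (J - w0) *m y)
    - (\sum_(p | S p) c p *: w p + (J - w0) *m (x *m y)) =
  \sum_(p | S p) c p *: (u p *m y + x *m v p - w p)
    + x *m J *m y - \sum_(p | S p) s p *: (x *m y).
Proof.
move=> w0; under [X in _ = X + _ - _]eq_bigr do
  rewrite scalerBr scalerDr scalemxAl scalemxAr.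
rewrite sumrB big_split -mulmx_suml -mulmx_sumr -scaler_suml /=.
rewrite !mulmxDl !mulmxDr !mulNmx !mulmxN !mul_scalar_mx.
rewrite -scalemxAl -scalemxAr !mulmxA.
move: (_ *m y) (x *m \sum_(p | _) _) (\sum_(p | _) _ *: w p) => a b d.
move: (J *m x *m y) (x *m J *m y) ((\sum_(p | _) s p) *: _) => f g h.
by apply/matrixP => i j; rewrite !mxE; ring.
Qed.

Lemma circ_explicitE (R : realType) k m n (T B : 'M[R[i]]_n)
    (lam t : 'I_m -> R[i]) (x y : matpow R m n) :
  circ k T B lam t x y = circ_explicit k T B lam t x y.
Proof.
have evalE (u v w z r : matpow R m n) a :
    (u * v + w * z - r) a = u a *m v a + w a *m z a - r a by rewrite !ffunE.
apply/ffunP => a; rewrite evalE !ffunE deformed_sumE.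
have -> : x a *m mxfrac (t a)%:M (T - (lam a)%:M) *m y a =
    t a *: (x a *m mxfrac 1%:M (T - (lam a)%:M) *m y a).
  by rewrite /mxfrac mul1mx mul_scalar_mx -scalemxAr -scalemxAl.
have xyE p : (x * y) p = x p *m y p by rewrite ffunE.
under [X in X + _ - _ = _]eq_bigr do rewrite xyE.
by [].
Qed.

Theorem proposition2 (R : realType) (k m n : nat)
    (hk : (0 < k)%N) (hm : (0 < m)%N) (hn : (0 < n)%N)
    (T B : 'M[R[i]]_n)
    (hB : B ^+ k = 1%:M)
    (hBT : B *m T = eps R k *: (T *m B))
    (lam t : 'I_m -> R[i])
    (hgen : generic k lam)
    (hT : forall alpha : 'I_m, T ^+ k - (lam alpha ^+ k)%:M \in unitmx) :
  [/\ forall x y : matpow R m n,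
        circ k T B lam t x y = circ_explicit k T B lam t x y,
      associative_product (circ k T B lam t)
    & compatible (circ k T B lam t)].
Proof.
have e_exprk := eps_exprk R hk.
have assoc : associative (circ k T B lam t).
  exact: (deformed_twisted_assoc t hk e_exprk hB hBT hgen hT).
have op_linear : linear (Rop k T B lam t).
  exact: (twisted_op_linear k (eps R k) T B lam t).
split; first exact: circ_explicitE.
- split=> [y|x|]; last exact: assoc.
    exact: deformed_linearl.
  exact: deformed_linearr.
- by move=> c; apply: deformed_compatible op_linear _ assoc.
Qed.
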